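(* Let $p$ be a prime and let $A=[0,l-1]\cup B\subseteq\mathbb{Z}_p$ be in normal form (as described in the context), with $B=\{a_1<\dots<a_k\}$, $k\ge1$, $\left|A\right|=m=l+k\geq 4$, and suppose $A$ is not an arithmetic progression. Suppose $2\,\widehat{}\,A$ is an interval with $|2\,\widehat{}\,A|<p-1$. Then: (a) If $2\,\widehat{}\,A$ is of the form $[1,c]$ and $a_{\min}=\min\{a\in B: l+k\le a\}$, then $|2\,\widehat{}\,A|\ge 2|A|-3+w(l+k-2,a_{\min})$. (b) If $2\,\widehat{}\,A$ is of the form $[d,p]\cup[1,2l-3]$ and $a_{\max}=\max\{a\in B: a\le p-k-1\}$, then $|2\,\widehat{}\,A|\ge 2|A|-3+w(a_{\max},p-k+2)$. (c) If $2\,\widehat{}\,A$ is of the form $[d,p]\cup[1,c]$ (equivalently $[d,p-1]\cup[0,c]$), let $B_1=\{a\in B: a\,\widehat{+}\,[0,l-1]\subset[0,c]\}$ and $B_2=\{a\in B: a\,\widehat{+}\,[0,l-1]\subset[d,p-1]\cup[0,2l-3]\}$, with $|B_1|=s$ and $|B_2|=k-s$; if $a_{\min}=\min\{a\in B_1: l+s\le a\}$ and $a_{\max}=\max\{a\in B_2: a\le p-k+s-1\}$, then $|2\,\widehat{}\,A|\ge 2|A|-3+w(l+s-2,a_{\min})+w(a_{\max},p-k+s+1)$.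
   Context: $p$ is a prime and $\mathbb{Z}_p$ the integers modulo $p$. Each residue class is identified with its representative in $\{0,1,\dots,p-1\}$, and $\mathbb{Z}_p$ is totally ordered by $\bar a_1\le\bar a_2$ iff $a_1\le a_2$ for these representatives; $\min$, $\max$ and inequalities between elements refer to this order. For $a_1\le a_2$, $[a_1,a_2]=\{a_1,a_1+1,\dots,a_2\}$. Expressions such as $[x,p]\cup[1,y]$ or $[x,p-1]\cup[0,y]$ denote ''wrap-around'' blocks of consecutive residues (the symbol $p$ denotes the class of $0$). A subset of $\mathbb{Z}_p$ is called an interval if it consists of consecutive residues (possibly wrapping around $p-1\to 0$). The width function is $w(a_1,a_2)=|a_1-a_2|-1$ if $a_1\ne a_2$ and $w(a_1,a_2)=0$ if $a_1=a_2$, computed on the integer values. For $X,Y\subseteq\mathbb{Z}_p$: $X+Y=\{x+y:x\in X,y\in Y\}$, $X\,\widehat{+}\,Y=\{x+y:x\in X,\ y\in Y,\ x\ne y\}$, $a\,\widehat{+}\,Y=\{a\}\,\widehat{+}\,Y$, and $2\,\widehat{}\,X=X\,\widehat{+}\,X$. An arithmetic progression of length $r$ is a set $\{a+id:0\le i\le r-1\}$ with $d\ne0$. Normal form: $A=[0,l-1]\cup B$ with $l\ge2$, where $[0,l-1]$ is an arithmetic progression of maximum length contained in $A$ (no arithmetic progression contained in $A$ has more than $l$ elements), and $B=\{a_1,\dots,a_k\}$, $a_1<\dots<a_k$, is disjoint from $[0,l-1]$. Standing assumption: $2\,\widehat{}\,A\ne\mathbb{Z}_p$.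
   Formalization: In (b) the second argument of w is p-k+1 instead of the printed p-k+2; the printed bound is false, e.g. p=11, A={0,1,2,9}, l=3, k=1, where |2^A|=6 but the bound would be 7. *)

(* Defs.v *)
From mathcomp Require Import all_boot all_order all_algebra.

Set Implicit Arguments.
Unset Strict Implicit.
Unset Printing Implicit Defensive.

Import GRing.Theory.

(* The order on 'Z_p is the order of nat through the coercion
   nat_of_ord : 'Z_p >-> nat, i.e. the order on representatives in
   {0, ..., p - 1} (for 1 < p). *)

(* The classes of the integers a, a + 1, ..., b (empty if b < a).  The
   endpoints are natural numbers, reduced modulo p only afterwards, so that
   block p d p contains the class of p, which is 0. *)
Definition block (p a b : nat) : {set 'Z_p} :=
  [set (i%:R)%R | i : 'I_b.+1 & a <= i].

Definition is_interval (p : nat) (X : {set 'Z_p}) : Prop :=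
  exists a b : nat, a <= b /\ X = block p a b.

Definition arith_prog (p : nat) (a d : 'Z_p) (r : nat) : {set 'Z_p} :=
  [set (a + d *+ i)%R | i : 'I_r].

Definition is_arith_prog (p : nat) (X : {set 'Z_p}) : Prop :=
  exists (a d : 'Z_p) (r : nat), d != 0%R /\ X = arith_prog a d r.

Definition rsum (p : nat) (X Y : {set 'Z_p}) : {set 'Z_p} :=
  [set (u.1 + u.2)%R | u in setX X Y & u.1 != u.2].

Definition rdouble (p : nat) (X : {set 'Z_p}) : {set 'Z_p} := rsum X X.

Definition width (a b : nat) : nat :=
  if a == b then 0 else `|a - b|%N - 1.

Definition normal_form (p : nat) (A : {set 'Z_p}) (l : nat) (B : {set 'Z_p})
    : Prop :=
  [/\ 2 <= l <= p,
      A = block p 0 (l - 1) :|: B,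
      [disjoint block p 0 (l - 1) & B]
    & forall X : {set 'Z_p}, is_arith_prog X -> X \subset A -> #|X| <= l].

Definition is_min (p : nat) (T : {set 'Z_p}) (a : 'Z_p) : Prop :=
  a \in T /\ forall b : 'Z_p, b \in T -> (a <= b)%N.

Definition is_max (p : nat) (T : {set 'Z_p}) (a : 'Z_p) : Prop :=
  a \in T /\ forall b : 'Z_p, b \in T -> (b <= a)%N.

(* Main.v *)
(* Let c < x < d be the gap of rdouble A.  It contains at least two elements,
   and B splits into a part below it and a part above it, which are bounded
   separately.  If the lower part has s elements, of which r are at least
   l + s, and c < a_min + l + s - 2, then the reflections c + 1 - b of these r
   elements and the point c + 2 - a_min are r + 1 elements of the window
   [l, l + s - 1] that are not in A, so that the window contains at most
   s - r - 1 elements of the lower part, one too few.  The upper part is treated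
   in the same way, with the window [p - s, p - 1] for its number s of
   elements and the points d - 1 and d - 2. *)

Require Import Defs.
From mathcomp Require Import all_boot all_order all_algebra zify.

Import GRing.Theory.

(** * Representatives, blocks and their cardinalities *)

Lemma val_Zp_small (p n : nat) : 1 < p -> n < p -> (n%:R : 'Z_p)%R = n :> nat.
Proof. by move=> p_gt1 n_lt_p; rewrite val_Zp_nat // modn_small. Qed.

Lemma ltn_Zp (p : nat) (x : 'Z_p) : 1 < p -> x < p.
Proof. by move=> p_gt1; rewrite -[X in _ < X](Zp_cast p_gt1) ltn_ord. Qed.

Lemma block_wit (p a b n : nat) : a <= n <= b -> (n%:R)%R \in block p a b.
Proof.
case/andP=> a_le_n n_le_b; apply/imsetP.
by exists (Ordinal (n_le_b : n < b.+1)); rewrite ?inE.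
Qed.

Lemma mem_block (p a b : nat) (x : 'Z_p) :
  1 < p -> b < p -> (x \in block p a b) = (a <= x <= b).
Proof.
move=> p_gt1 b_lt_p; apply/idP/idP => [/imsetP[i]|x_ab].
  rewrite inE => a_le_i ->.
  have i_le_b : i <= b by rewrite -ltnS.
  by rewrite val_Zp_small ?a_le_i // (leq_ltn_trans i_le_b).
by rewrite -[x]natr_Zp block_wit.
Qed.

Lemma mem_block0 (p b : nat) (x : 'Z_p) :
  1 < p -> (x \in block p 0 b) = (x <= b).
Proof.
move=> p_gt1; apply/idP/idP => [/imsetP[i] _ ->|x_le_b].
  by rewrite val_Zp_nat // (leq_trans (leq_mod _ _)) // -ltnS.
by rewrite -[x]natr_Zp block_wit.
Qed.

(** The endpoint [p] contributes the class 0, which satisfies [x <= c] anyway. Reduction modulo [p]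
    never raises an integer, so [c] may exceed [p]. *)
Lemma mem_wrap (p d c : nat) (x : 'Z_p) : 1 < p -> d <= p ->
  (x \in block p d p :|: block p 1 c) = (d <= x) || (x <= c).
Proof.
move=> p_gt1 d_le_p; rewrite inE; apply/idP/idP.
  case/orP=> /imsetP[i]; rewrite inE => ge_i ->; rewrite val_Zp_nat //.
    have i_le_p : i <= p by rewrite -ltnS.
    have [i_lt_p|p_le_i] := ltnP i p; first by rewrite modn_small ?ge_i.
    by rewrite (_ : nat_of_ord i = p) ?modnn ?orbT //; lia.
  by rewrite (leq_trans (leq_mod _ _)) ?orbT // -ltnS.
have x_lt_p := ltn_Zp p x p_gt1.
case/orP=> [d_le_x|x_le_c].
  by rewrite -[x]natr_Zp block_wit // d_le_x ltnW.
have [x_gt0|] := ltnP 0 x.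
  by rewrite orbC -[x]natr_Zp block_wit // x_gt0.
rewrite leqn0 => /eqP x0.
have -> : x = (p%:R)%R by rewrite pchar_Zp //; apply: val_inj.
by rewrite block_wit // d_le_p leqnn.
Qed.

Lemma card_Zp_range (p a b : nat) : 1 < p -> b <= p ->
  #|[set x : 'Z_p | a <= x < b]| = b - a.
Proof.
move=> p_gt1 b_le_p.
rewrite -[RHS]card_ord -(@card_imset _ _ (fun i : 'I_(b - a) => (a + i)%:R : 'Z_p)%R).
  apply: eq_card => x; rewrite inE; apply/idP/imsetP => [x_ab|[i _ ->]].
    have i_lt : x - a < b - a by lia.
    by exists (Ordinal i_lt) => //=; rewrite -[LHS]natr_Zp; congr (_%:R)%R; lia.
  by have i_lt := ltn_ord i; rewrite val_Zp_small; lia.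
move=> i j /(congr1 (@nat_of_ord _)) /=.
have i_lt := ltn_ord i; have j_lt := ltn_ord j.
by rewrite !val_Zp_small; [move=> /addnI/val_inj | lia..].
Qed.

(** The complement is the gap [c < x < d]; the truncated difference is 0 when the gap is empty. *)
Lemma card_wrap (p d c : nat) : 1 < p -> d <= p ->
  #|block p d p :|: block p 1 c| = p - (d - c.+1).
Proof.
move=> p_gt1 d_le_p; rewrite cardsCs card_ord.
rewrite (_ : ~: _ = [set x : 'Z_p | c < x < d]).
  by rewrite card_Zp_range ?Zp_cast.
by apply/setP => x; rewrite in_setC mem_wrap // inE; lia.
Qed.

Lemma width_lt (a b : nat) : a < b -> width a b = b - a - 1.
Proof. by rewrite /width => a_lt_b; case: eqP; lia. Qed.

(** * Reflecting outer elements into a window *)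

Lemma mem_rdouble (p : nat) (A : {set 'Z_p}) (x y : 'Z_p) :
  x \in A -> y \in A -> x != y -> (x + y)%R \in rdouble A.
Proof.
move=> xA yA neq_xy; apply/imsetP; exists (x, y) => //.
by rewrite !inE /= xA yA.
Qed.

(* The reflection [x |-> g - x] sends [B :\: W] into [W] but, [g] being outside
   [rdouble A], off [A]; with the further point [h - a], this makes
   [W :\: B] larger than [B :\: W]. *)
Lemma window_card (p : nat) (A B W : {set 'Z_p}) (g h a : 'Z_p) :
  B \subset A -> g \notin rdouble A -> h \notin rdouble A ->
  a \in B :\: W -> (h - a)%R \in W ->
  (forall b, b \in B :\: W -> (g - b)%R \in W /\ (g - b != h - a)%R) ->
  #|B| < #|W|.
Proof.
move=> sBA gN hN aBW haW gW.
(* Otherwise [u] would be the sum of [u - b] and [b], which are distinct because only the first lies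
   in [W]. *)
have offB u b : u \notin rdouble A -> b \in B :\: W -> (u - b)%R \in W ->
    (u - b)%R \in W :\: B.
  move=> uN; rewrite !inE => /andP[bNW bB] ubW; rewrite ubW andbT.
  apply: contra uN => ubB; rewrite -(subrK b u).
  apply: mem_rdouble; try exact: (subsetP sBA).
  by apply: contraNneq bNW => <-.
have : #|(h - a)%R |: [set (g - b)%R | b in B :\: W]| <= #|W :\: B|.
  apply/subset_leq_card/subsetP => x /setU1P[->|/imsetP[b bBW ->]].
    exact: offB.
  by apply: offB => //; case: (gW b bBW).
rewrite cardsU1 card_imset; last by move=> x y /addrI/oppr_inj.
have -> : ((h - a)%R \notin [set (g - b)%R | b in B :\: W]).
  by apply/imsetP => -[b /gW[_ /eqP]] /[swap] ->.
by rewrite -(cardsID W B) -(cardsID B W) setIC ltn_add2l.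
Qed.

(** Elements of [B] outside the window are at least [a], so their reflections [c + 1 - b] stay below
    [c + 2 - a], and [b + l <= c.+1] keeps them at least [l]. If the bound failed, [c + 2 - a] would
    lie in the window as well. *)
Lemma min_bound (p : nat) (A B : {set 'Z_p}) (l c : nat) (a : 'Z_p) :
  1 < p -> 0 < l -> c.+1 < p -> B \subset A ->
  (c.+1%:R)%R \notin rdouble A -> (c.+2%:R)%R \notin rdouble A ->
  (forall b, b \in B -> l <= b /\ b + l <= c.+1) ->
  is_min [set b in B | l + #|B| <= b] a ->
  a + l + #|B| <= c.+2.
Proof.
move=> p_gt1 l_gt0 c_lt sBA N1 N2 rangeB []; rewrite inE => /andP[aB a_ge] a_min.
rewrite leqNgt; apply/negP => c_small.
(* This includes [n = p], which occurs when [c.+2 = p]. *)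
have sub_val n (b : 'Z_p) : b <= n -> n - b < p ->
    (n%:R - b)%R = n - b :> nat.
  by move=> le lt; rewrite -[X in (_ - X)%R]natr_Zp -natrB // val_Zp_small.
pose W : {set 'Z_p} := [set x : 'Z_p | l <= x < l + #|B|].
have WP b : b \in B :\: W -> b \in B /\ a <= b.
  rewrite !inE => /andP[bNW bB]; split=> //; apply: a_min; rewrite inE bB.
  by have [] := rangeB b bB; lia.
have [a_gel a_lec] := rangeB a aB.
have : #|B| < #|W|.
  apply: (window_card p A B W (c.+1%:R)%R (c.+2%:R)%R a) => //.
  - by rewrite !inE aB; lia.
  - by rewrite inE sub_val; lia.
  move=> b /WP[bB a_le_b]; have [b_gel b_lec] := rangeB b bB.
  have vb := sub_val c.+1 b; have va := sub_val c.+2 a.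
  split; first by rewrite inE vb; lia.
  by apply/eqP=> /(congr1 (@nat_of_ord _)); rewrite vb ?va; lia.
rewrite card_Zp_range //; have := ltn_Zp p a p_gt1; lia.
Qed.

(** The reflections now wrap around: [d - 1 - b] has representative [p + d - 1 - b], below [p] since
    [d <= b], and above [p + d - 2 - a] since [b <= a]. *)
Lemma max_bound (p : nat) (A B : {set 'Z_p}) (d : nat) (a : 'Z_p) :
  1 < p -> 1 < d <= p -> B \subset A ->
  ((d - 1)%:R)%R \notin rdouble A -> ((d - 2)%:R)%R \notin rdouble A ->
  (forall b, b \in B -> d <= b) ->
  is_max [set b in B | b <= p - #|B| - 1] a ->
  d + #|B| <= a.+1.
Proof.
move=> p_gt1 /andP[d_gt1 d_le_p] sBA N1 N2 rangeB []; rewrite inE.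
move=> /andP[aB a_le] a_max.
rewrite leqNgt; apply/negP => a_small.
have sub_val n (b : 'Z_p) : n < b -> b < p -> (n%:R - b)%R = n + p - b :> nat.
  move=> lt bp; rewrite -[X in (_ - X)%R]natr_Zp -[X in (X - _)%R]addr0.
  rewrite -(pchar_Zp p_gt1) -natrD -natrB ?val_Zp_small //; lia.
pose W : {set 'Z_p} := [set x : 'Z_p | p - #|B| <= x < p].
have WP b : b \in B :\: W -> b \in B /\ b <= a.
  rewrite !inE => /andP[bNW bB]; split=> //; apply: a_max; rewrite inE bB.
  by have := ltn_Zp p b p_gt1; lia.
have a_ged := rangeB a aB; have a_lt_p := ltn_Zp p a p_gt1.
have : #|B| < #|W|.
  apply: (window_card p A B W ((d - 1)%:R)%R ((d - 2)%:R)%R a) => //.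
  - by rewrite !inE aB; lia.
  - by rewrite inE sub_val; lia.
  move=> b /WP[bB b_le_a]; have b_ged := rangeB b bB.
  have vb := sub_val (d - 1) b; have va := sub_val (d - 2) a.
  split; first by rewrite inE vb; lia.
  by apply/eqP=> /(congr1 (@nat_of_ord _)); rewrite vb ?va; lia.
rewrite card_Zp_range //; lia.
Qed.

(** * Position of the elements of [B] relative to the gap *)

(* The translates [b, b+1, ..., b+l-1] cannot jump over the gap [c < x < d]. *)
Lemma gap_side (p : nat) (A : {set 'Z_p}) (l c d : nat) (b : 'Z_p) :
  1 < p -> l <= p -> c.+1 < d <= p ->
  (forall x : 'Z_p, x < l -> x \in A) -> b \in A -> 0 < l <= b ->
  (forall x, x \in rdouble A -> (d <= x) || (x <= c)) ->
  (b + l <= c.+1) || (d <= b).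
Proof.
move=> p_gt1 l_le_p c_d Al bA l_b U.
have Ub j : j < l -> b + j < p -> (d <= b + j) || (b + j <= c).
  move=> j_lt bj_lt; have j_val := val_Zp_small p j p_gt1.
  have : (b + j%:R)%R \in rdouble A.
    apply: mem_rdouble => //; first by apply: Al; rewrite j_val; lia.
    by apply/eqP => /(congr1 (@nat_of_ord _)); rewrite j_val; lia.
  by move/U; rewrite -[X in (X + _)%R]natr_Zp -natrD val_Zp_small.
have [//|b_lt_d] := leqP d b; first by rewrite orbT.
(* A step of length 1 from at most [c] reaches at most [c + 1], which is still below [d]. *)
have step j : j < l -> b + j <= c.
  elim: j => [|j IHj] j_lt; first by have := Ub 0 j_lt; lia.
  by have := IHj (ltnW j_lt); have := Ub j.+1 j_lt; lia.
by have := step l.-1; lia.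
Qed.

(** Since [l <= a], the summands always differ, and the restricted sum is a full translate. *)
Lemma rsum_blockP (p l : nat) (a z : 'Z_p) : 1 < p -> 0 < l <= a ->
  reflect (exists2 j, j < l & z = (a + j)%:R%R)
          (z \in rsum [set a] (block p 0 (l - 1))).
Proof.
move=> p_gt1 l_a; have a_lt := ltn_Zp p a p_gt1.
apply: (iffP imsetP) => [[[x y]]|[j j_lt ->]].
  rewrite !inE /= mem_block0 // => /andP[/andP[/eqP-> y_lt] _] ->.
  by exists y; [lia | rewrite natrD !natr_Zp].
exists (a, j%:R%R); last by rewrite natrD natr_Zp.
have j_val : (j%:R : 'Z_p)%R = j :> nat by apply: val_Zp_small; lia.
rewrite !inE /= eqxx mem_block0 // j_val; apply/andP; split; first by lia.
by apply/eqP => /(congr1 (@nat_of_ord _)); rewrite j_val; lia.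
Qed.

(** Turns the definition of [B1] into an inequality: the translate contains [a] itself, and [a <= c]
    excludes [d <= a]. *)
Lemma rsum_block_low (p l c d : nat) (a : 'Z_p) :
  1 < p -> 0 < l <= a -> c < d <= p -> (a + l <= c.+1) || (d <= a) ->
  (rsum [set a] (block p 0 (l - 1)) \subset block p 0 c) = (a + l <= c.+1).
Proof.
move=> p_gt1 l_a c_d side; apply/subsetP/idP => [sub|a_le z].
  have := sub a; rewrite mem_block0 // => a_le_c.
  have : a <= c; last by lia.
  apply: a_le_c; apply/rsum_blockP => //.
  by exists 0; [lia | rewrite addn0 natr_Zp].
move/(rsum_blockP _ _ _ _ p_gt1 l_a) => [j j_lt ->].
by rewrite mem_block0 // val_Zp_small; lia.
Qed.

(** The same for [B2]. If [a < d], the last translate [a + l - 1] is at most [c], yet at least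
    [2 * l - 1], so it misses both blocks. If [d <= a], the wrapped translates are at most
    [l - 2]. *)
Lemma rsum_block_high (p l c d : nat) (a : 'Z_p) :
  1 < p -> 1 < l <= a -> c < d <= p -> (a + l <= c.+1) || (d <= a) ->
  (rsum [set a] (block p 0 (l - 1))
     \subset block p d (p - 1) :|: block p 0 (2 * l - 3)) = (d <= a).
Proof.
move=> p_gt1 l_a c_d side; have a_lt := ltn_Zp p a p_gt1.
have l_a' : 0 < l <= a by lia.
have memU x : (x \in block p d (p - 1) :|: block p 0 (2 * l - 3))
    = (d <= x) || (x <= 2 * l - 3).
  by rewrite inE mem_block ?mem_block0 //; have := ltn_Zp p x p_gt1; lia.
apply/subsetP/idP => [sub|d_le_a z].
  have [//|] := boolP (d <= a) => a_lt_d.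
  have := sub ((a + (l - 1))%:R)%R; rewrite memU val_Zp_small //; last by lia.
  have -> : ((a + (l - 1))%:R)%R \in rsum [set a] (block p 0 (l - 1)).
    by apply/rsum_blockP => //; exists (l - 1) => //; lia.
  by lia.
move/(rsum_blockP _ _ _ _ p_gt1 l_a') => [j j_lt ->]; rewrite memU.
have [lt|ge] := ltnP (a + j) p; first by rewrite val_Zp_small //; lia.
rewrite val_Zp_nat // -(subnK ge) modnDr modn_small; lia.
Qed.

(** * The three shapes of the restricted sumset *)

Theorem theorem3 (p : nat) (A B : {set 'Z_p}) (l k m : nat) :
  prime p ->
  normal_form A l B ->
  #|B| = k ->
  1 <= k ->
  #|A| = m ->
  m = l + k ->
  4 <= m ->
  ~ is_arith_prog A ->
  rdouble A <> [set: 'Z_p] ->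
  is_interval (rdouble A) ->
  #|rdouble A| < p - 1 ->
  [/\
    (* (a) *)
    forall c : nat,
      1 <= c < p ->
      rdouble A = block p 1 c ->
      forall a_min : 'Z_p,
        is_min [set a in B | l + k <= a] a_min ->
        #|rdouble A| >= 2 * #|A| - 3 + width (l + k - 2) a_min,
    (* (b) *)
    forall d : nat,
      1 <= d <= p ->
      rdouble A = block p d p :|: block p 1 (2 * l - 3) ->
      forall a_max : 'Z_p,
        is_max [set a in B | a <= p - k - 1] a_max ->
        #|rdouble A| >= 2 * #|A| - 3 + width a_max (p - k + 1)
  & (* (c) *)
    forall c d : nat,
      1 <= c < p ->
      1 <= d <= p ->
      rdouble A = block p d p :|: block p 1 c ->
      forall (B1 B2 : {set 'Z_p}) (s : nat),
        B1 = [set a in B |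
                rsum [set a] (block p 0 (l - 1)) \subset block p 0 c] ->
        B2 = [set a in B |
                rsum [set a] (block p 0 (l - 1))
                  \subset block p d (p - 1) :|: block p 0 (2 * l - 3)] ->
        #|B1| = s ->
        #|B2| = k - s /\
        (forall a_min a_max : 'Z_p,
          is_min [set a in B1 | l + s <= a] a_min ->
          is_max [set a in B2 | a <= p - k + s - 1] a_max ->
          #|rdouble A| >=
            2 * #|A| - 3 + width (l + s - 2) a_min
                         + width a_max (p - k + s + 1))].
Proof.
move=> p_pr [l_p defA disjB _] cardB k_gt0 <- cardA mA _ _ _ card_lt.
have p_gt1 := prime_gt1 p_pr.
have sBA : B \subset A by rewrite defA subsetUr.
have Al (x : 'Z_p) : x < l -> x \in A.
  by move=> x_lt; rewrite defA inE mem_block0 //; apply/orP; left; lia.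
have Bl b : b \in B -> l <= b.
  move=> bB; have : b \notin block p 0 (l - 1).
    by rewrite disjoint_sym in disjB; rewrite (disjointFr disjB bB).
  by rewrite mem_block0 //; lia.
have k_le_p : l + k <= p.
  by rewrite -cardA -[X in _ <= X](Zp_cast p_gt1) -[X in _ <= X]card_ord max_card.
split.
- move=> c /andP[c_gt0 c_lt_p] defD a min_a.
  have memD x : (x \in rdouble A) = (1 <= x <= c) by rewrite defD mem_block.
  have cardD : #|rdouble A| = c.
    have := card_Zp_range p 1 c.+1 p_gt1 c_lt_p; rewrite subn1 /= => <-.
    by apply: eq_card => x; rewrite memD inE ltnS.
  rewrite cardD in card_lt *.
  have rangeB b : b \in B -> l <= b /\ b + l <= c.+1.
    move=> bB; have l_b := Bl b bB; split=> //.
    (* Here [p] serves as the upper end of the gap, and no representative lies above it. *)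
    have : (b + l <= c.+1) || (p <= b).
      apply: (gap_side p A) => //; rewrite ?(subsetP sBA) //; try lia.
      by move=> x; rewrite memD => /andP[_ ->]; rewrite orbT.
    by have := ltn_Zp p b p_gt1; lia.
  have N1 : (c.+1%:R)%R \notin rdouble A.
    by rewrite memD val_Zp_small //; lia.
  have N2 : (c.+2%:R)%R \notin rdouble A.
    rewrite memD; have [c2_lt|p_le] := ltnP c.+2 p.
      by rewrite val_Zp_small //; lia.
    by rewrite (_ : c.+2 = p) ?pchar_Zp //; lia.
  have := min_bound p A B l c a p_gt1; rewrite cardB => bound.
  have {}bound : a + l + k <= c.+2 by apply: bound => //; lia.
  have [] := min_a; rewrite inE => /andP[_ a_ge] _.
  (* The right-hand side equals [a + l + k - 2], which [bound] keeps at most [c]. *)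
  by rewrite width_lt; lia.
- move=> d /andP[d_gt0 d_le_p] defD a max_a.
  have memD x : (x \in rdouble A) = (d <= x) || (x <= 2 * l - 3).
    by rewrite defD mem_wrap.
  have cardD := card_wrap p d (2 * l - 3) p_gt1 d_le_p.
  rewrite -defD in cardD; rewrite cardD in card_lt *.
  have rangeB b : b \in B -> d <= b.
    move=> bB; have l_b := Bl b bB.
    (* The first alternative would give [b <= l - 2], so all of [B] lies above the gap. *)
    have : (b + l <= (2 * l - 3).+1) || (d <= b).
      apply: (gap_side p A) => //; rewrite ?(subsetP sBA) //; try lia.
      by move=> x; rewrite memD.
    lia.
  have N n : 2 * l - 3 < n < d -> (n%:R)%R \notin rdouble A.
    by move=> n_gap; rewrite memD val_Zp_small //; lia.
  have := max_bound p A B d a p_gt1; rewrite cardB => bound.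
  have {}bound : d + k <= a.+1 by apply: bound => //; try apply: N; lia.
  have [] := max_a; rewrite inE => /andP[aB a_le] _; have l_a := Bl a aB.
  by rewrite width_lt; lia.
move=> c d /andP[c_gt0 c_lt_p] /andP[d_gt0 d_le_p] defD B1 B2 s defB1 defB2 cardB1.
have memD x : (x \in rdouble A) = (d <= x) || (x <= c) by rewrite defD mem_wrap.
have cardD := card_wrap p d c p_gt1 d_le_p.
rewrite -defD in cardD; rewrite cardD in card_lt *.
have side b : b \in B -> (b + l <= c.+1) || (d <= b).
  move=> bB; have l_b := Bl b bB.
  apply: (gap_side p A) => //; rewrite ?(subsetP sBA) //; try lia.
  by move=> x; rewrite memD.
have memB1 b : (b \in B1) = (b \in B) && (b + l <= c.+1).
  rewrite defB1 inE; have [bB|//] := boolP (b \in B); have l_b := Bl b bB.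
  by rewrite (rsum_block_low p l c d) ?side //; lia.
have memB2 b : (b \in B2) = (b \in B) && (d <= b).
  rewrite defB2 inE; have [bB|//] := boolP (b \in B); have l_b := Bl b bB.
  by rewrite (rsum_block_high p l c d) ?side //; lia.
(* By [side] one of the two inequalities holds, and [c < d] forbids both. *)
have defB2' : B2 = B :\: B1.
  apply/setP => b; rewrite memB2 inE memB1.
  by have [/side|] := boolP (b \in B); rewrite ?andbF //; lia.
have sB1B : B1 \subset B by apply/subsetP => b; rewrite memB1 => /andP[].
have s_le_k : s <= k by rewrite -cardB1 -cardB subset_leq_card.
have cardB2 : #|B2| = k - s by rewrite defB2' cardsD (setIidPr sB1B) cardB cardB1.
split=> // a b min_a max_b.
have N n : c < n < d -> (n%:R)%R \notin rdouble A.
  by move=> n_gap; rewrite memD val_Zp_small //; lia.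
have bound1 : a + l + s <= c.+2.
  rewrite -cardB1; apply: (min_bound p A) => //; try apply: N; try lia.
  - exact: subset_trans sBA.
  - by move=> x; rewrite memB1 => /andP[/Bl].
  - by rewrite cardB1.
have bound2 : d + (k - s) <= b.+1.
  rewrite -cardB2; apply: (max_bound p A) => //; try apply: N; try lia.
  - by rewrite defB2'; apply: subset_trans sBA; apply: subsetDl.
  - by move=> x; rewrite memB2 => /andP[].
  - by rewrite cardB2 (_ : p - (k - s) = p - k + s) //; lia.
have [] := min_a; rewrite inE => /andP[_ a_ge] _.
have [] := max_b; rewrite inE memB2 => /andP[/andP[bB _] b_le] _.
(* The widths are [a - l - s + 1] and [p - k + s - b]; adding [bound1] and [bound2] cancels [s] and
   leaves [p - d + c + 1], the size of the sumset. *)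
by have l_b := Bl b bB; rewrite !width_lt; lia.
Qed.
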